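(* Let $\Omega\subset\mathbb{R}^n$ be measurable with $|\Omega|<\infty$. Let $1<p<\infty$, $\theta>0$, and let $p'$ be the conjugate exponent of $p$. Then $$\left(GL_{p'}^{-\theta}(\Omega)\right)'=GL_p^\theta(\Omega)$$ and $$\sup_{\|g\|_{GL_{p'}^{-\theta}(\Omega)}=1}\int_\Omega f(x)g(x)\,dx\asymp\|f\|_{GL_p^\theta(\Omega)},$$ where $(\cdot)'$ denotes the Köthe dual (associate) space.
   Context: For $\theta\in\mathbb{R}$ and $0<p<\infty$, the space $GL_p^\theta(\Omega)$ is the set of real-valued measurable $f$ on $\Omega$ with finite $$\|f\|_{GL_p^\theta(\Omega)}=\begin{cases}\displaystyle\sup_{0<\varepsilon<1}\varepsilon^\theta\|f\|_{L_{p(\varepsilon)}(\Omega)},&\theta\geqslant 0,\\ \displaystyle\inf_{0<\varepsilon<\frac1p}\varepsilon^\theta\|f\|_{L_{p(-\varepsilon)}(\Omega)},&\theta<0,\end{cases}$$ where $\frac1{p(\varepsilon)}=\frac1p+\varepsilon$, $\frac1{p(-\varepsilon)}=\frac1p-\varepsilon$, and $\|f\|_{L_s(\Omega)}=(\int_\Omega|f|^s\,dx)^{1/s}$ for $0<s<\infty$. The Köthe dual $X'$ of such a space $X$ is the set of measurable $f$ on $\Omega$ with $\sup_{\|g\|_X=1}\int_\Omega|f(x)g(x)|\,dx<\infty$; equality of spaces is meant as sets with equivalent (quasi)norms. $A\asymp B$ means $C^{-1}B\leqslant A\leqslant CB$ with a constant $C>0$ not depending on $f$. *)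

(* Defs.v *)
From HB Require Import structures.
From mathcomp Require Import all_boot all_order all_algebra.
From mathcomp Require Import all_classical all_reals all_analysis.

Set Implicit Arguments.
Unset Strict Implicit.
Unset Printing Implicit Defensive.

Import Order.TTheory GRing.Theory Num.Theory.
Import numFieldNormedType.Exports.

Local Open Scope classical_set_scope.
Local Open Scope ring_scope.
Local Open Scope ereal_scope.

(* The n-dimensional Lebesgue measure (n >= 1) on the full sigma-algebra of
   Lebesgue measurable sets, obtained by the Caratheodory construction from
   the outer measure given by countable covers by closed boxes. The dimension
   is written n.+1. *)
Section lebesgue_outer.
Context (R : realType) (n : nat).
Implicit Types (A : set 'rV[R]_n.+1) (B : 'rV[R]_n.+1 * 'rV[R]_n.+1).

Definition box B : set 'rV[R]_n.+1 :=
  [set x | forall i, (B.1 ord0 i <= x ord0 i <= B.2 ord0 i)%R].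

Definition box_volume B : R := (\prod_i (B.2 ord0 i - B.1 ord0 i))%R.

Definition box_cover A : set (nat -> 'rV[R]_n.+1 * 'rV[R]_n.+1) :=
  [set B : nat -> 'rV[R]_n.+1 * 'rV[R]_n.+1 |
           (forall k i, ((B k).1 ord0 i <= (B k).2 ord0 i)%R) /\
           A `<=` \bigcup_k box (B k)].

Definition lebesgue_outer A : \bar R :=
  ereal_inf [set \sum_(k <oo) (box_volume (B k))%:E | B in box_cover A].

Let volume_ge0 A (B : nat -> 'rV[R]_n.+1 * 'rV[R]_n.+1) :
  box_cover A B -> forall k, 0 <= (box_volume (B k))%:E.
Proof.
by case=> B12 _ k; rewrite lee_fin prodr_ge0// => i _; rewrite subr_ge0.
Qed.

Let lebesgue_outer_ge0 A : 0 <= lebesgue_outer A.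
Proof.
apply: le_ereal_inf_tmp => _ [B AB <-].
by apply: nneseries_ge0 => k _ _; exact: volume_ge0 AB k.
Qed.

Let lebesgue_outer0 : lebesgue_outer set0 = 0.
Proof.
apply/eqP; rewrite eq_le lebesgue_outer_ge0 andbT.
apply: ereal_inf_lbound; exists (fun=> (0%R, 0%R)).
  by split => // k i; rewrite !mxE.
apply: eseries0 => k _ _; rewrite /box_volume big_ord_recl/=.
by rewrite !mxE subrr mul0r.
Qed.

Let le_lebesgue_outer : {homo lebesgue_outer : A B / A `<=` B >-> A <= B}.
Proof.
move=> A A' AA'; apply/ereal_inf_le_tmp => _ [B [B12 AB] <-].
by exists B => //; split => //; exact: subset_trans AA' AB.
Qed.

Let lebesgue_outer_sigma_subadditive : sigma_subadditive lebesgue_outer.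
Proof.
move=> A; have [[i ioo]|] := pselect (exists i, lebesgue_outer (A i) = +oo).
  rewrite (eseries_pinfty _ _ ioo) ?leey// => k _.
  by rewrite -ltNye (lt_le_trans _ (lebesgue_outer_ge0 _)).
rewrite -forallNE => Aoo.
apply/lee_addgt0Pr => _/posnumP[e].
rewrite (le_trans _ (epsilon_trick _ _ _))//.
pose P k (B : nat -> 'rV[R]_n.+1 * 'rV[R]_n.+1) := box_cover (A k) B /\
  \sum_(j <oo) (box_volume (B j))%:E <=
    lebesgue_outer (A k) + (e%:num / (2 ^ k.+1)%:R)%:E.
have [G PG] : {G : nat -> nat -> 'rV[R]_n.+1 * 'rV[R]_n.+1 &
    forall k, P k (G k)}.
  apply: (@choice _ _ P) => k.
  have en1 : (0 < e%:num / (2 ^ k.+1)%:R :> R)%R by [].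
  have Afin : lebesgue_outer (A k) \is a fin_num.
    by rewrite ge0_fin_numE// ltey; apply/eqP; exact: Aoo.
  have [_ [B AB <-] AkB] := lb_ereal_inf_adherent en1 Afin.
  by exists B; split => //; exact: ltW.
pose v (ij : nat * nat) : \bar R := (box_volume (G ij.1 ij.2))%:E.
have v0 ij : 0 <= v ij by exact: volume_ge0 (PG ij.1).1 ij.2.
apply: (@le_trans _ _ (\esum_(ij in setT) v ij)).
  have /card_esym/ppcard_eqP[f] := card_nat2.
  apply: ereal_inf_lbound; exists (fun k => G (f k).1 (f k).2).
    split=> [k i|x [k _ Akx]]; first exact: (PG (f k).1).1.1.
    have [j _ Gkjx] := (PG k).1.2 _ Akx.
    by exists (f^-1%FUN (k, j)) => //=; rewrite invK ?inE.
  rewrite -(esum_pred_image v f xpredT) ?[fun=> _]set_true//.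
  by rewrite image_eq.
rewrite (_ : esum _ _ = \sum_(i <oo) \sum_(j <oo) v (i, j)); last first.
  pose J : nat -> set (nat * nat) := fun i => [set (i, j) | j in setT].
  rewrite (_ : setT = \bigcup_k J k); last first.
    by rewrite predeqE => -[a b]; split => // _; exists a => //; exists b.
  rewrite esum_bigcupT//=; last first.
    apply/trivIsetP => i j _ _ ij.
    rewrite predeqE => -[a b] /=; split => //= -[] [_] _ [<-{a} _].
    by move=> [b' _] [] /esym/eqP; rewrite (negbTE ij).
  rewrite -(image_id [set: nat]) -fun_true esum_pred_image//; last first.
    by move=> k _; exact: esum_ge0.
  apply: eq_eseriesr => /= j _.
  rewrite -(esum_pred_image v (pair j) predT)//=; last first.
    by move=> ? ? _ _; exact: (@can_inj _ _ _ snd).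
  by congr esum; rewrite predeqE => -[a b]; split; move=> [i _ <-]; exists i.
apply: lee_nneseries => [k _ _|k _]; last exact: (PG k).2.
by apply: nneseries_ge0 => j _ _; exact: (v0 (k, j)).
Qed.

HB.instance Definition _ := isOuterMeasure.Build R 'rV[R]_n.+1 lebesgue_outer
  lebesgue_outer0 lebesgue_outer_ge0 le_lebesgue_outer
  lebesgue_outer_sigma_subadditive.

End lebesgue_outer.

Definition lebesgue_outer_measure (R : realType) (n : nat) :
  {outer_measure set 'rV[R]_n.+1 -> \bar R} := @lebesgue_outer R n.

Notation lebesgueRn R n := (caratheodory_type (@lebesgue_outer_measure R n)).

Definition lebesgue_measureRn (R : realType) (n : nat) :
    {measure set (lebesgueRn R n) -> \bar R} :=
  (lebesgue_outer_measure R n : set (lebesgueRn R n) -> \bar R).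

Section function_spaces.
Context d (T : measurableType d) (R : realType).
Variables (mu : {measure set T -> \bar R}) (Omega : set T).
Implicit Types (f g : T -> R) (p s theta : R).

(* A space of functions on Omega with its (quasi)norm; functions are total on
   T but only their values on Omega are ever used. *)
Record qnspace := QNSpace {
  carrier : set (T -> R);
  qnorm : (T -> R) -> \bar R }.

(* A(f) and B(f) are equivalent for f in D, with a constant independent of f *)
Definition asymp_on (D : set (T -> R)) (A B : (T -> R) -> \bar R) :=
  exists2 C : R, (0 < C)%R &
    forall f, D f -> C^-1%:E * B f <= A f <= C%:E * B f.

Definition eq_space (X Y : qnspace) :=
  carrier X = carrier Y /\ asymp_on (carrier X) (qnorm X) (qnorm Y).

(* For s > 0 the zero extension of f has the same Lnorm as f on Omega. *)
Definition Ls_norm s f : \bar R := 'N[mu]_(s%:E)[EFin \o (f \_ Omega)].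

Definition GL_norm p theta f : \bar R :=
  if (0 <= theta)%R then
    ereal_sup [set (eps `^ theta)%:E * Ls_norm (p^-1 + eps)^-1 f
              | eps in [set eps : R | (0 < eps < 1)%R]]
  else
    ereal_inf [set (eps `^ theta)%:E * Ls_norm (p^-1 - eps)^-1 f
              | eps in [set eps : R | (0 < eps < p^-1)%R]].

Definition GL p theta : qnspace :=
  QNSpace [set f | measurable_fun Omega f /\ GL_norm p theta f < +oo]
          (GL_norm p theta).

(* Supremum of F over the unit sphere of X, taken in [0, +oo]: it is 0 when
   the sphere is empty (this happens when mu Omega = 0). *)
Definition sphere_sup (X : qnspace) (F : (T -> R) -> \bar R) : \bar R :=
  maxe 0 (ereal_sup [set F g | g in [set g | carrier X g /\ qnorm X g = 1]]).

Definition Koethe_norm (X : qnspace) f : \bar R :=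
  sphere_sup X (fun g => \int[mu]_(x in Omega) `|f x * g x|%:E).

Definition Koethe_dual (X : qnspace) : qnspace :=
  QNSpace [set f | measurable_fun Omega f /\ Koethe_norm X f < +oo]
          (Koethe_norm X).

End function_spaces.

(* Main.v *)
Require Import Defs.
From mathcomp Require Import all_boot all_order all_algebra.
From mathcomp Require Import all_classical all_reals all_analysis.
From mathcomp Require Import measurable_realfun ring lra.

(** The two families of exponents are conjugate with the same parameter:
    1/p(eps) + 1/p'(-eps) = 1 as soon as 0 < eps < 1/p'. Write G for the norm
    of GL_p^theta, N for that of GL_p'^(-theta), S(f) for the supremum of the
    integral of f g over N(g) = 1, and K(f) for the same supremum with |f g|.
    The statement amounts to the chain G / C <= S <= K <= G, for a constant C
    that depends on theta, p' and the measure of Omega only; it holds on any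
    finite measure space, and [Koethe_dual_GL] proves it there.

    [K <= G]. By Hoelder with parameter eps, the integral of |f g| is at most
    (eps^theta ||f||_p(eps)) (eps^(-theta) ||g||_p'(-eps)); the first factor
    is at most G(f), and the infimum over eps of the second one is N(g). See
    [GL_hoelder].

    [G <= C S]. Let eps < 1/p' and s = p(eps) > 1. The function
    g = f |f|^(s-2) attains equality in Hoelder, and since N is an infimum,
    N(g) <= eps^(-theta) ||g||_p'(-eps); dividing g by N(g) gives
    eps^theta ||f||_s <= S(f). As f may fail to be integrable, this is done
    first on the sets where |f| <= k ([Ls_norm_le_sphere_sup_bounded]), where
    all quantities are finite and N(g) is nonzero by [GL_hoelder]; then k
    tends to infinity by monotone convergence ([Ls_norm_truncation]). The
    parameters 1/p' <= eps < 1, for which s <= 1, have no dual exponent; they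
    are dominated by the parameter 1/(2 p'), because on a set of finite
    measure the L_s norms increase with s up to a constant ([Ls_norm_le]). *)

Set Implicit Arguments.
Unset Strict Implicit.
Unset Printing Implicit Defensive.

Import Order.TTheory GRing.Theory Num.Theory.
Import numFieldNormedType.Exports.

Local Open Scope classical_set_scope.
Local Open Scope ring_scope.
Local Open Scope ereal_scope.

(** * The L_s norms over a measurable set *)

Section Ls_norm_theory.
Context d (T : measurableType d) (R : realType).
Context (mu : {measure set T -> \bar R}).
Implicit Types (D : set T) (f g : T -> R) (s t k c : R).

Lemma powR_le1 (x a : R) : (0 <= a)%R -> (0 <= x)%R -> (x <= 1)%R ->
  (x `^ a <= 1)%R.
Proof.
move=> a0 x0 x1; apply: (@le_trans _ _ (1 `^ a)%R); last by rewrite powR1.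
by apply: ge0_ler_powR; rewrite ?nnegrE.
Qed.

Lemma Ls_normE D s f : s != 0%R ->
  Ls_norm mu D s f = (\int[mu]_(x in D) (`|f x| `^ s)%:E) `^ s^-1.
Proof.
move=> s0; rewrite /Ls_norm Lnorm.unlock [in RHS]integral_mkcond.
congr (_ `^ _); apply: eq_integral => x _.
by rewrite /= !patchE; case: ifPn => //= _; rewrite normr0 powR0.
Qed.

Lemma Ls_norm_ge0 D s f : 0 <= Ls_norm mu D s f.
Proof. exact: Lnorm_ge0. Qed.

Lemma measurable_normr_powR D s f : measurable_fun D f ->
  measurable_fun D (EFin \o (fun x => `|f x| `^ s)%R).
Proof.
move=> mf; apply/measurable_EFinP.
apply: (@measurableT_comp _ _ _ _ _ _ (@powR R ^~ s)).
  exact: measurable_powR.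
exact: measurableT_comp.
Qed.

Lemma Ls_norm_poweR D s f : s != 0%R ->
  Ls_norm mu D s f `^ s = \int[mu]_(x in D) (`|f x| `^ s)%:E.
Proof.
move=> s0; rewrite Ls_normE// -poweRrM mulVf// poweRe1//.
by apply: integral_ge0 => x _; rewrite lee_fin powR_ge0.
Qed.

Lemma Ls_norm1 D f : Ls_norm mu D 1%R f = \int[mu]_(x in D) `|f x|%:E.
Proof.
rewrite Ls_normE ?oner_neq0// invr1 poweRe1; last first.
  by apply: integral_ge0 => x _; rewrite lee_fin powR_ge0.
by apply: eq_integral => x _; rewrite powRr1.
Qed.

Lemma Ls_norm_hoelder D f g s t : measurable D ->
    measurable_fun D f -> measurable_fun D g ->
    (0 < s)%R -> (0 < t)%R -> (s^-1 + t^-1 = 1)%R ->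
  \int[mu]_(x in D) `|f x * g x|%:E <= Ls_norm mu D s f * Ls_norm mu D t g.
Proof.
move=> mD mf mg s0 t0 st; rewrite -Ls_norm1.
have mfD : measurable_fun setT (f \_ D) by exact/(measurable_restrictT _ mD).
have mgD : measurable_fun setT (g \_ D) by exact/(measurable_restrictT _ mD).
apply: le_trans (hoelder mu mfD mgD s0 t0 st).
rewrite le_eqVlt; apply/orP; left; apply/eqP.
rewrite /Ls_norm.

apply: eq_Lnorm => x; rewrite /= !patchE; case: ifPn => //= _.
by rewrite mulr0.
Qed.

Lemma lee_poweR s (x y : \bar R) : (0 <= s)%R -> 0 <= x -> x <= y ->
  x `^ s <= y `^ s.
Proof.
move=> s0 x0 xy; apply: gt0_ler_poweR => //; rewrite in_itv/= leey andbT//.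
exact: le_trans xy.
Qed.

(** Hoelder for |f|^s and the constant 1, with exponents t/s and t/(t-s).
    It is used with s < 1 as well, where L_s has only a quasinorm. *)
Lemma Ls_norm_le D f s t : measurable D -> measurable_fun D f ->
    (0 < s)%R -> (s < t)%R ->
  Ls_norm mu D s f <= mu D `^ (s^-1 - t^-1) * Ls_norm mu D t f.
Proof.
move=> mD mf s0 st; have t0 := lt_trans s0 st.
have snz : s != 0%R by rewrite gt_eqF.
have tnz : t != 0%R by rewrite gt_eqF.
have tsnz : (t - s)%R != 0%R by rewrite subr_eq0 gt_eqF.
pose F x := (`|f x| `^ s)%R.
have mF : measurable_fun D F.
  by apply/measurable_EFinP; exact: measurable_normr_powR.
have NF : Ls_norm mu D (t / s)%R F = Ls_norm mu D t f `^ s.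
  rewrite !Ls_normE ?mulf_neq0 ?invr_eq0// -poweRrM invf_div.
  rewrite [in RHS]mulrC; congr (_ `^ _); apply: eq_integral => x _.
  by rewrite /F ger0_norm ?powR_ge0// -powRrM mulrCA divff ?mulr1.
have N1 : Ls_norm mu D (t / (t - s))%R (cst 1%R) = mu D `^ ((t - s) / t)%R.
  rewrite Ls_normE ?mulf_neq0 ?invr_eq0// invf_div.
  under eq_integral do rewrite /= normr1 powR1.
  by rewrite integral_cst// mul1e.
have := @Ls_norm_hoelder D F (cst 1%R) (t / s)%R (t / (t - s))%R mD mF.
rewrite NF N1 => /(_ (measurable_cst _)).
rewrite !divr_gt0 ?subr_gt0// !invf_div.
have -> : (s / t + (t - s) / t = 1)%R by field.
move=> /(_ erefl erefl erefl) H.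
rewrite Ls_normE//.
apply: (@le_trans _ _
  ((Ls_norm mu D t f `^ s * mu D `^ ((t - s) / t)%R) `^ s^-1)).
  apply: lee_poweR; first by rewrite invr_ge0 ltW.
    by apply: integral_ge0 => x _; rewrite lee_fin powR_ge0.
  apply: le_trans H; rewrite le_eqVlt; apply/orP; left; apply/eqP.
  apply: eq_integral => x _.
  by rewrite /F /= mulr1 (ger0_norm (powR_ge0 _ _)).
rewrite poweRM ?poweR_ge0// -!poweRrM divff// poweRe1 ?Ls_norm_ge0//.
rewrite muleC (_ : (t - s) / t / s = s^-1 - t^-1)%R//.
by field; apply/andP.
Qed.

Lemma Ls_normZ D f s c : measurable D -> measurable_fun D f -> (0 < s)%R ->
  Ls_norm mu D s (fun x => c * f x)%R = `|c|%:E * Ls_norm mu D s f.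
Proof.
move=> mD mf s0; have snz : s != 0%R by rewrite gt_eqF.
rewrite !Ls_normE//.
have -> : \int[mu]_(x in D) (`|c * f x| `^ s)%:E =
    (`|c| `^ s)%:E * \int[mu]_(x in D) (`|f x| `^ s)%:E.
  rewrite -ge0_integralZl_EFin ?powR_ge0//.
  - by apply: eq_integral => x _; rewrite normrM powRM.
  - exact: measurable_normr_powR.
rewrite poweRM ?lee_fin ?powR_ge0//; last first.
  by apply: integral_ge0 => x _; rewrite lee_fin powR_ge0.
by rewrite poweR_EFin -powRrM divff// powRr1.
Qed.

(** Bounds the powers of the measure coming from [Ls_norm_le] and
    [Ls_norm_bounded] uniformly in the exponent, whether the measure is
    smaller or larger than 1. *)
Lemma measure_poweR_le D (a b : R) : mu D < +oo -> (0 <= a)%R -> (a <= b)%R ->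
  mu D `^ a <= (Num.max 1 (fine (mu D)) `^ b)%:E.
Proof.
move=> Doo a0 ab; have Dfin : mu D \is a fin_num by rewrite ge0_fin_numE.
rewrite -(fineK Dfin) poweR_EFin lee_fin.
apply: (@le_trans _ _ (Num.max 1 (fine (mu D)) `^ a)%R).
  apply: ge0_ler_powR => //; rewrite ?nnegrE ?fine_ge0 ?le_max ?lexx ?orbT//.
  by rewrite ler01.
by apply: ler_powR => //; rewrite le_max lexx.
Qed.

Lemma Ls_norm_bounded D f s k : measurable D -> measurable_fun D f ->
    (0 < s)%R -> (0 <= k)%R -> (forall x, D x -> `|f x| <= k)%R ->
  Ls_norm mu D s f <= k%:E * mu D `^ s^-1.
Proof.
move=> mD mf s0 k0 fk; have snz : s != 0%R by rewrite gt_eqF.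
have -> : k%:E * mu D `^ s^-1 = ((k `^ s)%:E * mu D) `^ s^-1.
  rewrite poweRM ?lee_fin ?powR_ge0//.
  by rewrite poweR_EFin -powRrM divff// powRr1.
rewrite Ls_normE//; apply: lee_poweR; first by rewrite invr_ge0 ltW.
  by apply: integral_ge0 => x _; rewrite lee_fin powR_ge0.
rewrite -(integral_cst mu mD); apply: ge0_le_integral => //.
- exact: measurable_normr_powR.
- move=> x Dx; rewrite lee_fin.
  apply: ge0_ler_powR; rewrite ?nnegrE ?(ltW s0)//.
  exact: fk.
Qed.

Lemma measurable_normr_le D f k : measurable D -> measurable_fun D f ->
  measurable (D `&` [set x | `|f x| <= k]%R).
Proof.
move=> mD mf; have mnf : measurable_fun D (Num.norm \o f).
  exact: measurableT_comp.
rewrite [X in D `&` X](_ : _ = (Num.norm \o f) @^-1` `]-oo, k]).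
  exact: mnf.
by apply/seteqP; split => x /=; rewrite in_itv.
Qed.

(** Monotone convergence along the sets where |f| <= k. It reduces a bound on
    a possibly infinite norm to bounded functions. *)
Lemma Ls_norm_truncation D f s (B : \bar R) :
    measurable D -> measurable_fun D f -> (0 < s)%R ->
    (forall k : nat,
      Ls_norm mu (D `&` [set x | `|f x| <= k%:R]%R) s f <= B) ->
  Ls_norm mu D s f <= B.
Proof.
move=> mD mf s0 HB; have snz : s != 0%R by rewrite gt_eqF.
pose A (j : nat) := D `&` [set x | `|f x| <= j%:R]%R.
have B0 : 0 <= B by apply: le_trans (HB 0%N); exact: Ls_norm_ge0.
have mA (k : nat) : measurable (A k) by exact: measurable_normr_le.
have UA : \bigcup_k A k = D.
  apply/seteqP; split => [x [k _ []]//|x Dx].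
  exists (Num.bound `|f x|) => //; split => //=.
  by apply: ltW; rewrite archi_boundP.
have ndA : {homo A : n m / (n <= m)%N >-> (n <= m)%O}.
  move=> n m nm; apply/subsetPset => x [Dx fx]; split => //=.
  by apply: le_trans fx _; rewrite ler_nat.
have := @ge0_nondecreasing_set_cvg_integral _ _ _ A
  (EFin \o (fun x => `|f x| `^ s)%R) mu ndA mA.
rewrite UA => cv.
have {}cv : \int[mu]_(x in A k) (`|f x| `^ s)%:E @[k --> \oo] -->
    \int[mu]_(x in D) (`|f x| `^ s)%:E.
  apply: cv => [k|k x _]; last by rewrite lee_fin powR_ge0.
  apply: measurable_normr_powR; apply: measurable_funS mf => //.
  by move=> x [].
have intB : \int[mu]_(x in D) (`|f x| `^ s)%:E <= B `^ s.
  rewrite -(cvg_lim _ cv)//; apply: lime_le.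
    by apply/cvg_ex; eexists; exact: cv.
  apply: nearW => k; rewrite -Ls_norm_poweR//.
  by apply: lee_poweR; [exact: ltW|exact: Ls_norm_ge0|exact: HB].
rewrite Ls_normE//; apply: (@le_trans _ _ ((B `^ s) `^ s^-1)).
  apply: lee_poweR => //; first by rewrite invr_ge0 ltW.
  by apply: integral_ge0 => x _; rewrite lee_fin powR_ge0.
by rewrite -poweRrM divff// poweRe1.
Qed.

End Ls_norm_theory.

(** * The norms of the spaces GL *)

Section GL_norm_theory.
Context d (T : measurableType d) (R : realType).
Context (mu : {measure set T -> \bar R}) (Omega : set T).
Implicit Types (f g : T -> R) (q a eps c : R).

Lemma GL_norm_nnegE q a f : (0 <= a)%R -> GL_norm mu Omega q a f = ereal_sup
  [set (eps `^ a)%:E * Ls_norm mu Omega (q^-1 + eps)^-1 f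
  | eps in [set eps : R | (0 < eps < 1)%R]].
Proof. by rewrite /GL_norm => ->. Qed.

Lemma GL_norm_negE q a f : (a < 0)%R -> GL_norm mu Omega q a f = ereal_inf
  [set (eps `^ a)%:E * Ls_norm mu Omega (q^-1 - eps)^-1 f
  | eps in [set eps : R | (0 < eps < q^-1)%R]].
Proof. by move=> a0; rewrite /GL_norm leNgt a0. Qed.

Lemma GL_norm_ge q a f eps : (0 <= a)%R -> (0 < eps < 1)%R ->
  (eps `^ a)%:E * Ls_norm mu Omega (q^-1 + eps)^-1 f <= GL_norm mu Omega q a f.
Proof.
by move=> a0 e01; rewrite GL_norm_nnegE//; apply: ereal_sup_ubound; exists eps.
Qed.

Lemma GL_norm_neg_le q a f eps : (a < 0)%R -> (0 < eps < q^-1)%R ->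
  GL_norm mu Omega q a f <= (eps `^ a)%:E * Ls_norm mu Omega (q^-1 - eps)^-1 f.
Proof.
by move=> a0 e01; rewrite GL_norm_negE//; apply: ereal_inf_lbound; exists eps.
Qed.

Lemma GL_norm_ge0 q a f : 0 <= GL_norm mu Omega q a f.
Proof.
have [a0|a0] := leP 0%R a.
  apply: le_trans (@GL_norm_ge q a f 2^-1 a0 _).
    by rewrite mule_ge0 ?lee_fin ?powR_ge0 ?Ls_norm_ge0.
  by apply/andP; split; lra.
rewrite GL_norm_negE//; apply/ereal_infP => _ [eps _ <-].
by rewrite mule_ge0 ?lee_fin ?powR_ge0 ?Ls_norm_ge0.
Qed.

(** An infimum of norms need not be subadditive, but it is homogeneous, which
    is what normalizing a test function onto the unit sphere requires. *)
Lemma GL_norm_negZ q a g c : measurable Omega -> measurable_fun Omega g ->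
    (a < 0)%R -> (0 < c)%R ->
  GL_norm mu Omega q a (fun x => c * g x)%R = c%:E * GL_norm mu Omega q a g.
Proof.
move=> mO mg a0 c0; rewrite !GL_norm_negE// -ereal_inf_pZl// image_comp.
congr ereal_inf; apply: eq_imagel => eps /= /andP[e0 ep].
by rewrite Ls_normZ ?invr_gt0 ?subr_gt0// gtr0_norm// muleCA.
Qed.

Lemma sphere_sup_ge0 (X : qnspace T R) F : 0 <= sphere_sup X F.
Proof. by rewrite /sphere_sup le_max lexx. Qed.

End GL_norm_theory.

(** * Duality on a set of finite measure *)

Section GL_duality.
Context d (T : measurableType d) (R : realType).
Context (mu : {measure set T -> \bar R}) (Omega : set T).
Context (mO : measurable Omega) (Ofin : mu Omega < +oo).
Context (p p' theta : R) (p1 : (1 < p)%R) (pp' : (p^-1 + p'^-1 = 1)%R).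
Context (theta0 : (0 < theta)%R).
Implicit Types (f g : T -> R) (eps k : R).

Local Notation G := (GL_norm mu Omega p theta).
Local Notation N := (GL_norm mu Omega p' (- theta)%R).
Local Notation M := (Num.max 1 (fine (mu Omega)))%R.
Local Notation S f := (sphere_sup (GL mu Omega p' (- theta)%R)
  (fun g => \int[mu]_(x in Omega) (f x * g x)%:E)).
Local Notation K := (Koethe_norm mu Omega (GL mu Omega p' (- theta)%R)).

Lemma one_le_max_measure : (1 <= M)%R.
Proof. by rewrite le_max lexx. Qed.

Lemma invp_gt0 : (0 < p^-1)%R.
Proof. by rewrite invr_gt0 (lt_trans _ p1). Qed.

Lemma invp_lt1 : (p^-1 < 1)%R.
Proof. by rewrite invf_lt1// (lt_trans _ p1). Qed.

Lemma invp'_gt0 : (0 < p'^-1)%R.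
Proof. by move: pp' invp_lt1 => /eqP; lra. Qed.

Lemma invp'_lt1 : (p'^-1 < 1)%R.
Proof. by move: pp' invp_gt0 => /eqP; lra. Qed.

Lemma Ntheta_lt0 : (- theta < 0)%R.
Proof. by rewrite oppr_lt0. Qed.

(** The finiteness of G(f) excludes the product of +oo with 0 on the right,
    which is 0 by convention. *)
Lemma GL_hoelder f g : measurable_fun Omega f -> measurable_fun Omega g ->
    G f < +oo ->
  \int[mu]_(x in Omega) `|f x * g x|%:E <= G f * N g.
Proof.
move=> mf mg Gfoo; have Gfin : G f \is a fin_num.
  by rewrite ge0_fin_numE ?GL_norm_ge0.
have H eps : (0 < eps < p'^-1)%R -> \int[mu]_(x in Omega) `|f x * g x|%:E <=
    G f * ((eps `^ (- theta))%:E * Ls_norm mu Omega (p'^-1 - eps)^-1 g).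
  move=> /andP[e0 ep].
  have e1 : (0 < eps < 1)%R by rewrite e0 (lt_trans ep invp'_lt1).
  have s0 : (0 < p^-1 + eps)%R by rewrite addr_gt0 ?invp_gt0.
  have t0 : (0 < p'^-1 - eps)%R by rewrite subr_gt0.
  apply: (le_trans (Ls_norm_hoelder mu (s := (p^-1 + eps)^-1)
    (t := (p'^-1 - eps)^-1) mO mf mg _ _ _)); rewrite ?invr_gt0 ?invrK//.
    by rewrite -pp'; ring.
  rewrite muleA lee_wpmul2r ?Ls_norm_ge0// muleC.
  rewrite powRN lee_pdivlMl ?powR_gt0//; exact: GL_norm_ge (ltW theta0) _.
(* If G(f) = 0, a single parameter eps already gives the claim; the scaling of
   the infimum needs a positive factor. *)
have [G0|G0] := eqVneq (G f) 0.
  have := H (p'^-1 / 2)%R; rewrite G0 !mul0e; apply.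
  by apply/andP; split; move: invp'_gt0; lra.
have fG : (0 < fine (G f))%R by rewrite fine_gt0// lt0e G0 GL_norm_ge0/=.
rewrite -(fineK Gfin) (GL_norm_negE _ _ _ _ Ntheta_lt0) -ereal_inf_pZl//.
apply/ereal_infP.
by move=> _ [_ [eps e0p <-] <-]; rewrite fineK//; exact: H.
Qed.

(** Makes [GL_hoelder] applicable to truncated functions. *)
Lemma GL_norm_bounded f k : measurable_fun Omega f -> (0 <= k)%R ->
  (forall x, Omega x -> `|f x| <= k)%R -> G f < +oo.
Proof.
move=> mf k0 fk; apply: (@le_lt_trans _ _ (k * M `^ 2)%:E); last exact: ltry.
rewrite (GL_norm_nnegE _ _ _ _ (ltW theta0)).
apply/ereal_supP => _ [eps /= /andP[e0 e1] <-].
have s0 : (0 < p^-1 + eps)%R by rewrite addr_gt0 ?invp_gt0.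
apply: (@le_trans _ _ (1 * (k%:E * (M `^ 2)%:E))); last by rewrite mul1e.
apply: lee_pmul; rewrite ?lee_fin ?powR_ge0 ?Ls_norm_ge0//.
  by apply: powR_le1; exact: ltW.
apply: (le_trans (Ls_norm_bounded mu mO mf _ k0 fk)); first by rewrite invr_gt0.
rewrite invrK lee_wpmul2l//; apply: measure_poweR_le; first by [].
  exact: ltW.
by move: invp_lt1; lra.
Qed.

(** The extremal function of Hoelder on A is f |f|^(s-2), extended by zero: its
    product with f is |f|^s, and so is the r-th power of its modulus for the
    exponent r conjugate to s. With J the integral of |f|^s over A this gives
    N(g) <= eps^(-theta) J^(1/r), whence the quotient J / N(g) is at least
    eps^theta J^(1/s). *)
Lemma Ls_norm_le_sphere_sup_bounded A f k eps :
    measurable A -> A `<=` Omega -> measurable_fun Omega f ->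
    (0 <= k)%R -> (forall x, A x -> `|f x| <= k)%R -> (0 < eps < p'^-1)%R ->
  (eps `^ theta)%:E * Ls_norm mu A (p^-1 + eps)^-1 f <= S f.
Proof.
move=> mA AO mf k0 fk /[dup] eint /andP[e0 ep].
have mfA : measurable_fun A f by exact: measurable_funS mf.
have u0 : (0 < p^-1 + eps)%R by rewrite addr_gt0 ?invp_gt0.
have u1 : (p^-1 + eps < 1)%R by move: pp' => /eqP; lra.
have v0 : (0 < p'^-1 - eps)%R by rewrite subr_gt0.
have uv : (p'^-1 - eps = 1 - (p^-1 + eps))%R by move: pp' => /eqP; lra.
set s := (p^-1 + eps)^-1%R; set r := (p'^-1 - eps)^-1%R.
have s1 : (1 < s)%R by rewrite invf_gt1.
have s0 : (0 < s)%R by rewrite invr_gt0.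
have r0 : (0 < r)%R by rewrite invr_gt0.
have snz : s != 0%R by rewrite gt_eqF.
have rnz : r != 0%R by rewrite gt_eqF.
have sr : ((s - 1) * r = s)%R.
  rewrite /r /s uv; move: u0 u1; move: (p^-1 + eps)%R => u u0 u1.
  by field; rewrite subr_eq0 !gt_eqF.
have srV : (s^-1 + r^-1 = 1)%R by rewrite /s /r !invrK uv; ring.
pose F x := (`|f x| `^ s)%R.
have mF : measurable_fun A (EFin \o F) by exact: measurable_normr_powR.
(* Written without a sign function: at the zeros of f the first factor
   vanishes, whatever value the power takes there. *)
pose g := (fun x => f x * `|f x| `^ (s - 2))%R \_ A.
have mg : measurable_fun Omega g.
  apply: measurable_funTS; apply/(measurable_restrictT _ mA).
  apply: measurable_funM => //.
  by apply/measurable_EFinP; exact: measurable_normr_powR.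
have powr_sub1 (u : R) : (`|u * `|u| `^ (s - 2)| = `|u| `^ (s - 1))%R.
  rewrite normrM (ger0_norm (powR_ge0 _ _)).
  have [->|unz] := eqVneq u 0%R.
    by rewrite normr0 mul0r powR0// subr_eq0 gt_eqF.
  have nu : (0 < `|u|)%R by rewrite normr_gt0.
  rewrite -{1}(powRr1 (ltW nu)) -powRD; last by rewrite (gt_eqF nu) implybT.
  by congr (_ `^ _)%R; ring.
have powr_mul (u : R) : (u * (u * `|u| `^ (s - 2)) = `|u| `^ s)%R.
  have [->|unz] := eqVneq u 0%R; first by rewrite normr0 mul0r powR0.
  have nu : (0 < `|u|)%R by rewrite normr_gt0.
  rewrite mulrA -expr2 -normr_id -real_normK ?num_real// -powR_mulrn//.
  rewrite normr_id -powRD; last by rewrite (gt_eqF nu) implybT.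
  by congr (_ `^ _)%R; ring.
have IA (h : T -> \bar R) : \int[mu]_(x in A) h x =
    \int[mu]_(x in Omega) (h \_ A) x.
  by rewrite -integral_mkcondr (setIidr AO).
have intA c : (0 <= c)%R ->
    \int[mu]_(x in Omega) (f x * (c * g x))%:E =
    c%:E * \int[mu]_(x in A) (F x)%:E.
  move=> c0; rewrite -ge0_integralZl_EFin//; last first.
    by move=> x _; rewrite lee_fin powR_ge0.
  rewrite IA; apply: eq_integral => x _.
  rewrite /g !patchE; case: ifPn => // _; last by rewrite !mulr0.
  by rewrite mulrCA powr_mul.
have intabsA : \int[mu]_(x in Omega) `|(f \_ A) x * g x|%:E =
    \int[mu]_(x in A) (F x)%:E.
  rewrite IA; apply: eq_integral => x _.
  rewrite /g !patchE; case: ifPn => // _; last by rewrite mulr0 normr0.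
  by rewrite powr_mul ger0_norm ?powR_ge0.
have Ng : Ls_norm mu Omega r g = (\int[mu]_(x in A) (F x)%:E) `^ r^-1.
  rewrite Ls_normE//; congr (_ `^ _).
  rewrite IA; apply: eq_integral => x _.
  rewrite /g !patchE; case: ifPn => // _; last by rewrite normr0 powR0.
  by rewrite powr_sub1 -powRrM sr.
rewrite Ls_normE//.
have mu_A : mu A < +oo.
  by apply: le_lt_trans Ofin; apply: le_measure; rewrite ?inE.
have Ioo : \int[mu]_(x in A) (F x)%:E < +oo.
  apply: (@le_lt_trans _ _ ((k `^ s)%:E * mu A)).
    rewrite -(integral_cst mu mA); apply: ge0_le_integral => //.
      by move=> x _; rewrite lee_fin powR_ge0.
    move=> x Ax; rewrite lee_fin /F.
    apply: ge0_ler_powR; rewrite ?nnegrE ?(ltW s0)//.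
    exact: fk.
  by rewrite lte_mul_pinfty// ?lee_fin ?powR_ge0.
have I0 : 0 <= \int[mu]_(x in A) (F x)%:E.
  by apply: integral_ge0 => x _; rewrite lee_fin powR_ge0.
move: I0 Ioo intA intabsA Ng.
rewrite -/F; set J := \int[mu]_(x in A) (F x)%:E => J0 Joo intA intabsA Ng.
have [JE|Jnz] := eqVneq J 0.
  by rewrite JE (poweR0r (invr_neq0 snz)) mule0 sphere_sup_ge0.
have Jfin : J \is a fin_num by rewrite ge0_fin_numE.
have [I JI] : exists I, J = I%:E by exists (fine J); rewrite fineK.
have I0 : (0 < I)%R by rewrite -lte_fin -JI lt0e Jnz.
have Nle : N g <= (eps `^ (- theta) * I `^ r^-1)%:E.
  apply: le_trans (GL_norm_neg_le _ _ _ Ntheta_lt0 eint) _.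
  by rewrite -/r Ng JI poweR_EFin EFinM.
have Nfin : N g \is a fin_num.
  by rewrite ge0_fin_numE ?GL_norm_ge0//; apply: le_lt_trans Nle _; exact: ltry.
have mfA' : measurable_fun Omega (f \_ A).
  by apply: measurable_funTS; exact/(measurable_restrictT _ mA).
(* N(g) is an infimum of positive numbers; that it does not vanish follows from
   the Hoelder inequality applied to the truncation of f. *)
have Nnz : N g != 0.
  apply: contra_neq Jnz => N0; apply: le_anti; rewrite J0 andbT -intabsA.
  apply: le_trans (GL_hoelder mfA' mg _) _; last by rewrite N0 mule0.
  apply: (GL_norm_bounded mfA' k0) => x _; rewrite patchE.
  by case: ifPn => [/set_mem/fk//|_]; rewrite normr0.
have [c Nc] : exists c, N g = c%:E by exists (fine (N g)); rewrite fineK.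
have c0 : (0 < c)%R by rewrite -lte_fin -Nc lt0e Nnz GL_norm_ge0.
apply: (@le_trans _ _ (c^-1 * I)%:E).
  rewrite JI poweR_EFin -EFinM lee_fin ler_pdivlMl//.
  move: Nle; rewrite Nc lee_fin => Nle.
  apply: (@le_trans _ _ ((eps `^ (- theta) * I `^ r^-1) *
                         (eps `^ theta * I `^ s^-1))%R).
    by apply: ler_wpM2r => //; rewrite mulr_ge0 ?powR_ge0.
  rewrite mulrACA -powRD; last by rewrite (gt_eqF e0) implybT.
  rewrite -powRD; last by rewrite (gt_eqF I0) implybT.
  by rewrite addNr powRr0 mul1r addrC srV (powRr1 (ltW I0)).
rewrite EFinM -JI -intA ?invr_ge0 ?(ltW c0)//.
rewrite /sphere_sup le_max; apply/orP; right.
apply: ereal_sup_ubound; exists (fun x => c^-1 * g x)%R => //=.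
have Nu : N (fun x => c^-1 * g x)%R = 1.
  rewrite (GL_norm_negZ _ _ mO mg Ntheta_lt0) ?invr_gt0// Nc -EFinM.
  by rewrite mulVf ?gt_eqF.
split; last exact: Nu.
split; first exact: measurable_funM.
by rewrite /= Nu ltry.
Qed.

Lemma Ls_norm_le_sphere_sup f eps :
    measurable_fun Omega f -> (0 < eps < p'^-1)%R ->
  (eps `^ theta)%:E * Ls_norm mu Omega (p^-1 + eps)^-1 f <= S f.
Proof.
move=> mf /[dup] eint /andP[e0 ep].
have s0 : (0 < p^-1 + eps)%R by rewrite addr_gt0 ?invp_gt0.
rewrite -lee_pdivlMl ?powR_gt0//.
apply: Ls_norm_truncation => //; first by rewrite invr_gt0.
move=> k; rewrite lee_pdivlMl ?powR_gt0//.
apply: (@Ls_norm_le_sphere_sup_bounded _ _ k%:R) => //.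
- exact: measurable_normr_le.
- by move=> x [].
Qed.

Local Notation eps0 := (p'^-1 / 2)%R.
Local Notation C := (M * eps0 `^ (- theta))%R.

Lemma eps0_gt0 : (0 < eps0)%R.
Proof. by rewrite divr_gt0 ?invp'_gt0. Qed.

Lemma one_le_const : (1 <= C)%R.
Proof.
rewrite -[leLHS]mulr1 ler_pM ?one_le_max_measure//.
rewrite powRN invf_ge1 ?powR_gt0 ?eps0_gt0//.
apply: powR_le1; [exact: ltW|exact: ltW eps0_gt0|].
by move: invp'_lt1; lra.
Qed.

(** For eps < 1/p' the bound holds with constant 1. For the other parameters
    eps^theta <= 1, and the exponent p(eps) is smaller than p(eps0) with
    eps0 = 1/(2 p'), so that the L_s norm is controlled at the cost of M, and
    passing from ||f||_p(eps0) to S(f) costs eps0^(-theta). *)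
Lemma GL_norm_le_sphere_sup f : measurable_fun Omega f -> G f <= C%:E * S f.
Proof.
move=> mf; have e0int : (0 < eps0 < p'^-1)%R.
  by rewrite eps0_gt0/=; move: invp'_gt0; lra.
rewrite (GL_norm_nnegE _ _ _ _ (ltW theta0)).
apply/ereal_supP => _ [eps /= /andP[e0 e1] <-].
have [ep|pe] := ltP eps p'^-1%R.
  apply: (@le_trans _ _ (S f)).
    by apply: Ls_norm_le_sphere_sup => //; rewrite e0 ep.
  by rewrite -[leLHS]mul1e lee_wpmul2r ?sphere_sup_ge0 ?lee_fin ?one_le_const.
have s0 : (0 < p^-1 + eps)%R by rewrite addr_gt0 ?invp_gt0.
have s00 : (0 < p^-1 + eps0)%R by rewrite addr_gt0 ?invp_gt0 ?eps0_gt0.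
have e0e : (eps0 < eps)%R by apply: lt_le_trans pe; case/andP: e0int.
apply: (@le_trans _ _ (1 * (M%:E * Ls_norm mu Omega (p^-1 + eps0)^-1 f))).
  apply: lee_pmul; rewrite ?lee_fin ?powR_ge0 ?Ls_norm_ge0//.
    by apply: powR_le1; exact: ltW.
  apply: le_trans (@Ls_norm_le _ _ _ mu Omega f (p^-1 + eps)^-1
    (p^-1 + eps0)^-1 mO mf _ _) _; rewrite ?invr_gt0//.
    by rewrite ltf_pV2 ?posrE// ltrD2l.
  rewrite !invrK lee_wpmul2r ?Ls_norm_ge0//.
  (* The gap 1/s - 1/s0 = eps - eps0 lies in [0, 1], hence M^1 suffices. *)
  rewrite -[in leRHS](powRr1 (le_trans ler01 one_le_max_measure)).
  by apply: measure_poweR_le => //; move: e0e eps0_gt0; lra.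
have M0 := le_trans ler01 one_le_max_measure.
rewrite mul1e EFinM -muleA lee_wpmul2l ?lee_fin ?M0//.
rewrite powRN lee_pdivlMl ?powR_gt0 ?eps0_gt0//; exact: Ls_norm_le_sphere_sup.
Qed.

(** The integral of f g need not converge absolutely; it is at most the
    integral of its positive part in every case. *)
Lemma sphere_sup_le_Koethe f : measurable_fun Omega f -> S f <= K f.
Proof.
move=> mf; rewrite /Koethe_norm /sphere_sup ge_max le_max lexx/=.
apply/ereal_supP => _ [g [[mg Ng] N1] <-]; rewrite le_max; apply/orP; right.
apply: (@le_trans _ _ (\int[mu]_(x in Omega) `|f x * g x|%:E)); last first.
  by apply: ereal_sup_ubound; exists g; split.
have mfg : measurable_fun Omega (EFin \o (fun x => f x * g x)%R).
  by apply/measurable_EFinP; exact: measurable_funM.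
rewrite integralE -[leRHS]sube0 leeB//; last exact: integral_ge0.
apply: ge0_le_integral => //.
- exact: measurable_funepos.
- by apply/measurable_EFinP/measurableT_comp => //; exact: measurable_funM.
- move=> x _; rewrite funeposE /=.
  by rewrite -EFin_max lee_fin ge_max ler_norm normr_ge0.
Qed.

Lemma Koethe_le_GL_norm f : measurable_fun Omega f -> K f <= G f.
Proof.
move=> mf; rewrite /Koethe_norm /sphere_sup ge_max GL_norm_ge0/=.
apply/ereal_supP => _ [g [[mg _] N1] <-].
have [->|Gfoo] := eqVneq (G f) +oo; first exact: leey.
rewrite -[leRHS]mule1 -[X in _ * X]N1; apply: GL_hoelder => //.
by rewrite ltey.
Qed.

Theorem Koethe_dual_GL :
  eq_space (Koethe_dual mu Omega (GL mu Omega p' (- theta)%R))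
           (GL mu Omega p theta) /\
  asymp_on [set f | measurable_fun Omega f]
    (fun f => sphere_sup (GL mu Omega p' (- theta)%R)
       (fun g => \int[mu]_(x in Omega) (f x * g x)%:E))
    (GL_norm mu Omega p theta).
Proof.
have C0 : (0 < C)%R by exact: lt_le_trans one_le_const.
have le_C (x : \bar R) : 0 <= x -> x <= C%:E * x.
  by move=> x0; rewrite -[leLHS]mul1e lee_wpmul2r ?lee_fin ?one_le_const.
have GCK f : measurable_fun Omega f -> G f <= C%:E * K f.
  move=> mf; apply: le_trans (GL_norm_le_sphere_sup mf) _.
  by rewrite lee_wpmul2l ?lee_fin ?(ltW C0)// sphere_sup_le_Koethe.
split; last first.
  exists C => // f mf; rewrite lee_pdivrMl//; apply/andP; split.
    exact: GL_norm_le_sphere_sup.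
  apply: le_trans (sphere_sup_le_Koethe mf) _.
  apply: le_trans (Koethe_le_GL_norm mf) _.
  exact/le_C/GL_norm_ge0.
split.
  apply/seteqP; split => f [mf /= foo]; split => //.
    apply: le_lt_trans (GCK f mf) _.
    by rewrite lte_mul_pinfty ?lee_fin ?(ltW C0).
  exact: le_lt_trans (Koethe_le_GL_norm mf) foo.
exists C => // f [mf _]; rewrite lee_pdivrMl//; apply/andP; split.
  exact: GCK.
by apply: le_trans (Koethe_le_GL_norm mf) _; exact/le_C/GL_norm_ge0.
Qed.

End GL_duality.

Theorem theorem6p2 (R : realType) (n : nat) (Omega : set (lebesgueRn R n))
    (p p' theta : R) :
  measurable Omega -> lebesgue_measureRn R n Omega < +oo ->
  (1 < p)%R -> (p^-1 + p'^-1 = 1)%R -> (0 < theta)%R ->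
  let mu := lebesgue_measureRn R n in
  eq_space (Koethe_dual mu Omega (GL mu Omega p' (- theta)%R))
           (GL mu Omega p theta) /\
  asymp_on [set f | measurable_fun Omega f]
    (fun f => sphere_sup (GL mu Omega p' (- theta)%R)
       (fun g => \int[mu]_(x in Omega) (f x * g x)%:E))
    (GL_norm mu Omega p theta).
Proof. by move=> *; exact: Koethe_dual_GL. Qed.
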